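(* Unweighted SSSD enumeration cannot be solved with delay in $o(\Delta)$, even if the graph is connected and has constant average degree. That is, for every algorithm for unweighted SSSD enumeration there are connected input graphs of constant average degree and arbitrarily large maximum degree $\Delta$ on which some delay of the algorithm is $\Omega(\Delta)$.
   Context: Input: an unweighted (directed or undirected) graph $G=(V,E)$ with $V=\{1,\dots,n\}$ and a source $s\in V$, given as read-only adjacency lists; the algorithm may query the degree of any vertex and the next neighbor in any vertex's adjacency list. $\Delta$ denotes the maximum (out-)degree. $d(s,t)$ is the hop distance from $s$ to $t$ ($\infty$ if unreachable, $d(s,s)=0$). SSSD enumeration: output, for each $t\in V$, the pair $(t,d(s,t))$ exactly once. Delay: maximum time until the first output, between consecutive outputs, and from the last output until termination is signalled (no preprocessing beyond this). *)

(* Defs.v *)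
From mathcomp Require Import all_boot all_order all_algebra.

Set Implicit Arguments.
Unset Strict Implicit.
Unset Printing Implicit Defensive.

Import Order.TTheory GRing.Theory Num.Theory.

(* Vertices are 0, ..., n-1.  The order within an adjacency list is part of
   the input.  An undirected graph is a graph whose arc relation [grel G] is
   symmetric: every edge is listed at both of its endpoints. *)
Record graph (n : nat) : Type := Graph {
  adj :> 'I_n -> seq 'I_n;
  adj_uniq : forall u, uniq (adj u);
  adj_irrefl : forall u, u \notin adj u
}.

Definition max_degree (n : nat) (G : graph n) : nat := \max_(v < n) size (G v).

(* For a directed graph this is strong connectivity. *)
Definition connected_graph (n : nat) (G : graph n) : Prop :=
  forall u v, connect (grel G) u v.

(* The sum of the out-degrees is the number of arcs of a directed graph and
   twice the number of edges of an undirected one. *)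
Definition average_degree (n : nat) (G : graph n) : rat :=
  ((\sum_(v < n) size (G v))%N%:R / n%:R)%R.

(* [None] stands for infinity. *)
Definition is_dist (n : nat) (G : graph n) (s t : 'I_n) (d : option nat) :=
  match d with
  | Some k =>
      (exists p, [/\ path (grel G) s p, last s p = t & size p = k]) /\
      (forall p, path (grel G) s p -> last s p = t -> k <= size p)
  | None => forall p, path (grel G) s p -> last s p <> t
  end.

(* One instruction takes one unit of time.  The continuation receives the
   answer to a query.  Each vertex has a cursor in its adjacency list:
   [Next v] returns the neighbor under the cursor ([None] past the end of the
   list) and advances the cursor; [Rewind v] moves it back to the front. *)
Variant instr (n : nat) (M : Type) : Type :=
  | Compute of M
  | Degree of 'I_n & (nat -> M)
  | Next of 'I_n & (option 'I_n -> M)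
  | Rewind of 'I_n & M
  | Output of 'I_n & option nat & M
  | Halt.

(* A deterministic algorithm.  It is given n and the source, and it learns
   about the graph only through its queries.  The set [mem] of memory contents
   and the effect of a single [Compute] are unrestricted, so that every RAM
   program, with its unit-cost operations, is an instance. *)
Record algorithm : Type := Algorithm {
  mem : Type;
  init : forall n : nat, 'I_n -> mem;
  step : forall n : nat, mem -> instr n mem
}.

(* Each emitted pair is logged with the time at which it is emitted. *)
Record config (n : nat) (M : Type) : Type := Config {
  memory : M;
  cursor : 'I_n -> nat;
  clock : nat;
  log : seq (('I_n * option nat) * nat);
  halted : bool
}.

Definition start (A : algorithm) (n : nat) (s : 'I_n) : config n (mem A) :=
  Config (init A s) (fun=> 0) 0 [::] false.

Definition tick (A : algorithm) (n : nat) (G : graph n)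
    (q : config n (mem A)) : config n (mem A) :=
  let: Config m cur t out h := q in
  if h then q else
  match step n m with
  | Compute m' => Config m' cur t.+1 out false
  | Degree v k => Config (k (size (G v))) cur t.+1 out false
  | Next v k =>
      Config (k (onth (G v) (cur v))) [eta cur with v |-> (cur v).+1]
             t.+1 out false
  | Rewind v m' => Config m' [eta cur with v |-> 0] t.+1 out false
  | Output v d m' => Config m' cur t.+1 (rcons out ((v, d), t.+1)) false
  | Halt => Config m cur t.+1 out true
  end.

(* A halted configuration is fixed by [tick], so there is at most one such q,
   and its clock shows the time of the [Halt]. *)
Definition final (A : algorithm) (n : nat) (G : graph n) (s : 'I_n)
    (q : config n (mem A)) : Prop :=
  (exists k, q = iter k (tick G) (start A s)) /\ halted q.

Definition correct_output (n : nat) (G : graph n) (s : 'I_n)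
    (out : seq ('I_n * option nat)) : Prop :=
  perm_eq [seq o.1 | o <- out] (enum 'I_n) /\
  forall o, o \in out -> is_dist G s o.1 o.2.

Definition graph_class : Type := forall n : nat, graph n -> Prop.

Definition solves_SSSD (P : graph_class) (A : algorithm) : Prop :=
  forall (n : nat) (G : graph n) (s : 'I_n), P n G ->
  exists2 q, final G s q & correct_output G s (map fst (log (q : config n (mem A)))).

(* The times to the first output, between consecutive outputs, and from the
   last output to termination. *)
Definition delays (n : nat) (M : Type) (q : config n M) : seq nat :=
  pairmap (fun t t' => t' - t) 0 (rcons (map snd (log q)) (clock q)).

Definition has_delay (A : algorithm) (n : nat) (G : graph n) (s : 'I_n)
    (d : nat) : Prop :=
  exists2 q : config n (mem A), final G s q & d \in delays q.

Definition delay_in_little_o_max_degree (P : graph_class) (A : algorithm) :=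
  forall eps : rat, (0 < eps)%R ->
  exists D : nat, forall (n : nat) (G : graph n) (s : 'I_n) (d : nat),
    P n G -> D <= max_degree G -> has_delay A G s d ->
    (d%:R <= eps * (max_degree G)%:R)%R.

Definition inputs (directed : bool) : graph_class :=
  fun n G => ~~ directed -> symmetric (grel G).

Definition sparse_connected_inputs (directed : bool) (C : rat) : graph_class :=
  fun n G => [/\ inputs directed G, connected_graph G &
                 (average_degree G <= C)%R].

(* Main.v *)
(* Run the algorithm on the disjoint union of K_{m,m}, containing s, and a path
   on m^2 + 1 vertices.  Within (m-1)^2 steps it leaves some edge ab of K_{m,m}
   with a <> s on the side of s, and some edge cd of the path, unread from both
   ends.  Replacing ab, cd by ac, bd, or by ad, bc, gives two connected graphs
   on which the run is the same so far.  As d(s,a) = 2 and d(s,b) = 1, every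
   path vertex has different distances in the two graphs, so none has been
   output: at most 2m outputs share (m-1)^2 steps. *)
Require Import Defs.
From mathcomp Require Import all_boot all_order all_algebra.
From mathcomp Require Import perm zify.

Import Order.TTheory GRing.Theory Num.Theory.

(** * Pigeonhole arguments for long delays and unread edges *)

(** The differences telescope; truncated subtraction can only enlarge the sum. *)
Lemma leq_sumn_pairmap (z x : nat) (s : seq nat) :
  z <= x + sumn (pairmap (fun t t' => t' - t) x (rcons s z)).
Proof.
elim: s x => [|y s IH] x /=; first by lia.
by have := IH y; lia.
Qed.

Lemma leq_sumn_size (s : seq nat) :
  s != [::] -> exists2 d, d \in s & sumn s <= d * size s.
Proof.
elim: s => [//|x s IH] _.
have [->|s0] := eqVneq s [::]; first by exists x; rewrite ?mem_head //= muln1 addn0.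
have [d ds le] := IH s0.
have [dx|xd] := leqP d x.
  by exists x; rewrite ?mem_head //= mulnS leq_add2l (leq_trans le) // leq_mul2r dx orbT.
by exists d; rewrite ?inE ?ds ?orbT //= mulnS leq_add // ltnW.
Qed.

(** The [size l1 + 1] delays up to the first event after [l1], an output or the halt, sum to at
    least [T], and the largest is at least their mean. *)
Lemma exists_delay_ge (n : nat) (M : Type) (q : config n M) (T : nat) l1 l2 :
  log q = l1 ++ l2 -> all (leq T) (map snd l2) -> T <= clock q ->
  exists2 d, d \in delays q & T <= d * (size l1).+1.
Proof.
move=> lq l2T qT; set f := fun t t' => t' - t.
have [z [r [zT zr]]] : exists z r, T <= z /\ rcons (map snd l2) (clock q) = z :: r.
  case: l2 l2T {lq} => [|o l2] /=; first by exists (clock q), [::].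
  by case/andP=> ? _; exists o.2, (rcons (map snd l2) (clock q)).
have dq : delays q = pairmap f 0 (rcons (map snd l1) z) ++ pairmap f z r.
  by rewrite /delays lq map_cat rcons_cat zr -cat_rcons pairmap_cat last_rcons.
set s := pairmap f 0 _ in dq.
have ss : size s = (size l1).+1 by rewrite size_pairmap size_rcons size_map.
have [|d ds le] := @leq_sumn_size s; first by rewrite -size_eq0 ss.
exists d; first by rewrite dq mem_cat ds.
rewrite -ss; apply: leq_trans le; apply: leq_trans zT _.
exact: (leq_sumn_pairmap z 0).
Qed.

(** Otherwise each edge of [E] is in [L] in some orientation. Orienting [L] upwards by [g] then
    covers [E] with at most [size L] pairs. *)
Lemma exists_unoriented_notin (n : nat) (L E : seq ('I_n * 'I_n)) :
  uniq E -> (forall e, e \in E -> e.1 < e.2) -> size L < size E ->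
  exists u v, [/\ (u, v) \in E, (u, v) \notin L & (v, u) \notin L].
Proof.
move=> Eu Elt LE.
have [/hasP[[u v] uvE /andP[h1 h2]]|] :=
  boolP (has (fun e => ((e.1, e.2) \notin L) && ((e.2, e.1) \notin L)) E).
  by exists u, v.
move/hasPn => h.
pose g (e : 'I_n * 'I_n) := if e.1 < e.2 then e else (e.2, e.1).
suff /(uniq_leq_size Eu) : {subset E <= map g L}.
  by rewrite size_map leqNgt LE.
move=> [u v] uvE; have /= uv := Elt _ uvE.
have /= := h _ uvE; rewrite negb_and !negbK => /orP[] inL; apply/mapP.
  by exists (u, v) => //; rewrite /g /= uv.
by exists (v, u) => //; rewrite /g /= ltnNge ltnW.
Qed.

(** * Runs and the adjacency entries they read *)

Section Runs.

Context {n : nat} {A : algorithm}.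
Implicit Types (G H : graph n) (q : config n (Defs.mem A)).

(** Reading past the end of a list is no probe: it reveals only the degree, which switches
    preserve. *)
Definition probe G q : option ('I_n * 'I_n) :=
  if halted q then None else
  if step n (memory q) is Next v _ then omap (pair v) (onth (G v) (cursor q v))
  else None.

Definition probes G q T : seq ('I_n * 'I_n) :=
  pmap (probe G) (traject (tick G) q T).

Lemma size_probes G q T : size (probes G q T) <= T.
Proof. by rewrite size_pmap (leq_trans (count_size _ _)) ?size_map ?size_traject. Qed.

Lemma iter_tick_halted G q k : halted q -> iter k (tick G) q = q.
Proof. by move=> hq; elim: k => //= k ->; case: q hq => ? ? ? ? []. Qed.

Lemma clock_iter_tick G q k :
  ~~ halted (iter k (tick G) q) -> clock (iter k (tick G) q) = clock q + k.
Proof.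
elim: k => [|k IH] /=; first by rewrite addn0.
case: (iter k _ q) IH => mm cur t out [] //= IH.
by rewrite addnS -IH //; case: (step n mm).
Qed.

Lemma log_iter_tick G q k :
  clock q <= clock (iter k (tick G) q) /\
  exists2 l, log (iter k (tick G) q) = log q ++ l & all (leq (clock q)) (map snd l).
Proof.
elim: k => [|k [IH1 [l IH2 IH3]]]; first by split=> //; exists [::] => //; rewrite cats0.
rewrite iterS; case: (iter k _ q) IH1 IH2 => mm cur t out [] /= tq ol.
  by split=> //; exists l.
case: (step n mm) => [m'|v f|v f|v m'|v d m'|] /=;
  (split; first exact: leqW); try by exists l.
exists (rcons l (v, d, t.+1)); first by rewrite ol rcons_cat.
by rewrite map_rcons all_rcons /= IH3 leqW.
Qed.

End Runs.

(** * Switching two edges *)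

Section Switch.

Context {n : nat}.
Implicit Types (G : graph n) (a b c d u v : 'I_n).

(** Relabels the list of [u]: at [a], [b] becomes [c]; at [d], [c] becomes [b]; at [b], [a] becomes
    [d]; at [c], [d] becomes [a]. A permutation keeps the list free of repetitions. *)
Definition switch_perm a b c d u : {perm 'I_n} :=
  if u \in [:: a; d] then tperm b c else if u \in [:: b; c] then tperm a d else 1%g.

Lemma switch_permK a b c d u : involutive (switch_perm a b c d u).
Proof.
by move=> v; rewrite /switch_perm; case: ifP => _; [|case: ifP => _];
  rewrite ?tpermK ?perm1.
Qed.

Lemma switch_uniq G a b c d u : uniq (map (switch_perm a b c d u) (G u)).
Proof. by rewrite map_inj_uniq ?adj_uniq //; apply: perm_inj. Qed.

Lemma mem_switch G a b c d u v :
  (v \in map (switch_perm a b c d u) (G u)) = (switch_perm a b c d u v \in G u).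
Proof. by rewrite -{1}(switch_permK a b c d u v) mem_map //; apply: perm_inj. Qed.

(** [u] is a fixed point of its own relabelling, so no loop arises. *)
Lemma switch_irrefl G a b c d u : uniq [:: a; b; c; d] ->
  u \notin map (switch_perm a b c d u) (G u).
Proof.
move=> abcd; rewrite mem_switch.
suff -> : switch_perm a b c d u u = u by exact: adj_irrefl.
move: abcd; rewrite /= !inE !negb_or => /and4P[/and3P[ab ac ad] /andP[bc bd] cd _].
rewrite /switch_perm !inE.
case: ifP => [/orP[]/eqP->|_]; first by rewrite tpermD // eq_sym.
  by rewrite tpermD.
case: ifP => [/orP[]/eqP->|_]; rewrite ?perm1 //.
  by rewrite tpermD // eq_sym.
by rewrite tpermD // eq_sym.
Qed.

(* The edges ab and cd become ac and bd.  Each new neighbor takes the place of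
   the lost one in the list, so that degrees are unchanged and a run notices
   nothing unless it reads one of the four entries. *)
Definition switch G a b c d (abcd : uniq [:: a; b; c; d]) : graph n :=
  Graph (switch_uniq G a b c d) (fun u => switch_irrefl G a b c d u abcd).

(** At [a] only the entries [b] and [c] are relabelled: the probe hypothesis excludes [b], and [c]
    is not adjacent to [a]. Likewise at [b], [c] and [d]; degrees are unchanged. *)
Lemma tick_switch A G a b c d (abcd : uniq [:: a; b; c; d])
    (q : config n (Defs.mem A)) :
  a \notin G c -> c \notin G a -> b \notin G d -> d \notin G b ->
  (forall e, probe G q = Some e -> e \notin [:: (a, b); (b, a); (c, d); (d, c)]) ->
  tick (switch G a b c d abcd) q = tick G q.
Proof.
move=> ac ca bd db; case: q => mm cur t out [] //.
rewrite /probe /=; case: (step n mm) => // v f; first by rewrite size_map.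
rewrite onth_map; case Ev: (onth _ _) => [x|] //= nprb.
have xG : x \in G v by apply/onthP; exists (cur v).
congr (Config (f (Some _))  _ _ _ _).
have := nprb _ erefl; rewrite !inE !xpair_eqE !negb_or.
rewrite /switch_perm !inE => /and4P[h1 h2 h3 h4].
case: ifP => [vad|_]; [|case: ifP => [vbc|_]]; last by rewrite perm1.
  rewrite tpermD //; case/orP: vad xG h1 h2 h3 h4 => /eqP-> xG;
    rewrite ?eqxx ?andbT //=; by [move=> *; rewrite eq_sym | move=> *; apply: contraTneq xG => <-].
rewrite tpermD //; case/orP: vbc xG h1 h2 h3 h4 => /eqP-> xG;
  rewrite ?eqxx ?andbT //=; by [move=> *; rewrite eq_sym | move=> *; apply: contraTneq xG => <-].
Qed.

Lemma iter_tick_switch A G a b c d (abcd : uniq [:: a; b; c; d])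
    (q : config n (Defs.mem A)) T :
  a \notin G c -> c \notin G a -> b \notin G d -> d \notin G b ->
  {in probes G q T, forall e, e \notin [:: (a, b); (b, a); (c, d); (d, c)]} ->
  iter T (tick (switch G a b c d abcd)) q = iter T (tick G) q.
Proof.
move=> ac ca bd db; elim: T => //= T IH nprb.
have prbS e : e \in probes G q T.+1 = (e \in probes G q T) || (probe G (iter T (tick G) q) == Some e).
  by rewrite /probes trajectSr -cats1 pmap_cat mem_cat /=; case: probe => //= x; rewrite inE eq_sym.
rewrite IH => [|e eL]; last by apply: nprb; rewrite prbS eL.
by apply: tick_switch => // e Ee; apply: nprb; rewrite prbS Ee eqxx orbT.
Qed.

Lemma arc_switch G a b c d (abcd : uniq [:: a; b; c; d]) u v :
  symmetric (grel G) -> b \in G a -> d \in G c -> c \notin G a -> d \notin G b ->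
  (v \in switch G a b c d abcd u) =
    (v \in G u) && ((u, v) \notin [:: (a, b); (b, a); (c, d); (d, c)])
    || ((u, v) \in [:: (a, c); (c, a); (b, d); (d, b)]).
Proof.
move=> Gsym; have sym x y : (y \in G x) = (x \in G y) := Gsym x y.
move=> ab cd nac nbd; rewrite [LHS]mem_switch.
have [ba dc] : a \in G b /\ c \in G d by rewrite (sym b) (sym d).
have [nca ndb] : a \notin G c /\ b \notin G d by rewrite (sym c) (sym d).
have := abcd; rewrite /= !inE !negb_or !andbT.
case/and3P=> /and3P[/negPf Eab /negPf Eac /negPf Ead] /andP[/negPf Ebc /negPf Ebd] /negPf Ecd.
(* All distinctness facts, in both directions, bundled for rewriting. *)
pose E := (Eab, Eac, Ead, Ebc, Ebd, Ecd,
  etrans (eq_sym _ _) Eab, etrans (eq_sym _ _) Eac, etrans (eq_sym _ _) Ead,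
  etrans (eq_sym _ _) Ebc, etrans (eq_sym _ _) Ebd, etrans (eq_sym _ _) Ecd, eqxx).
rewrite /switch_perm !inE !xpair_eqE.
have [->|ua] := eqVneq u a.
  rewrite ?E /=; case: tpermP => [->|->|/eqP/negPf-> /eqP/negPf->];
    by rewrite ?E ?ab ?(negPf nac) ?andbT ?orbF.
have [->|ub] := eqVneq u b.
  rewrite ?E /=; case: tpermP => [->|->|/eqP/negPf-> /eqP/negPf->];
    by rewrite ?E ?ba ?(negPf nbd) ?andbT ?orbF.
have [->|uc] := eqVneq u c.
  rewrite ?E /=; case: tpermP => [->|->|/eqP/negPf-> /eqP/negPf->];
    by rewrite ?E ?dc ?cd ?(negPf nca) ?andbT ?orbF.
have [->|ud] := eqVneq u d.
  rewrite ?E /=; case: tpermP => [->|->|/eqP/negPf-> /eqP/negPf->];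
    by rewrite ?E ?dc ?(negPf ndb) ?andbT ?orbF.
by rewrite /= perm1 andbT orbF.
Qed.

Lemma switch_sym G a b c d (abcd : uniq [:: a; b; c; d]) :
  symmetric (grel G) -> b \in G a -> d \in G c -> c \notin G a -> d \notin G b ->
  symmetric (grel (switch G a b c d abcd)).
Proof.
move=> Gsym ab cd nac nbd u v /=; rewrite !arc_switch // [v \in G u]Gsym /=.
(* Both lists of four arcs are closed under reversal. *)
congr (_ && ~~ _ || _); rewrite !inE !xpair_eqE !(andbC (u == _)).
  by do 4!case: (_ && _).
by do 4!case: (_ && _).
Qed.

End Switch.

(** * The disjoint union of K_{m,m} and a path *)

(** The sides of K_{m,m} are the numbers below [m] and the next [m]; the path runs through the rest
    in increasing order. Stated on [nat], adjacency is linear arithmetic. *)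
Definition hard_edge (m u v : nat) : bool :=
  [|| (u < m) && (m <= v < m + m), (v < m) && (m <= u < m + m)
    | [&& m + m <= u, m + m <= v & (u == v.+1) || (v == u.+1)]].

Section Hard.

Context {m n : nat}.
Implicit Types (a b c d u v x : 'I_n).

Lemma hard_uniq u : uniq [seq v : 'I_n <- enum 'I_n | hard_edge m u v].
Proof. by rewrite filter_uniq ?enum_uniq. Qed.

Lemma hard_irrefl u : u \notin [seq v : 'I_n <- enum 'I_n | hard_edge m u v].
Proof. by rewrite mem_filter mem_enum /hard_edge andbT; lia. Qed.

Definition hard : graph n := Graph hard_uniq hard_irrefl.

Lemma mem_hard u v : (v \in hard u) = hard_edge m u v.
Proof. by rewrite mem_filter mem_enum andbT. Qed.

Lemma hard_sym : symmetric (grel hard).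
Proof. by move=> u v /=; rewrite !mem_hard /hard_edge; lia. Qed.

(** Vertex 0 is kept for the source, so [a] differs from it. The path edge cd may have either
    orientation: exchanging [c] and [d] gives the other switch. *)
Definition good_switch a b c d : bool :=
  [&& 0 < a < m, m <= b < m + m, m + m <= c, m + m <= d
    & (c == d.+1 :> nat) || (d == c.+1 :> nat)].

Lemma good_switchC a b c d : good_switch a b c d -> good_switch a b d c.
Proof. by rewrite /good_switch; lia. Qed.

Lemma good_switch_uniq a b c d : good_switch a b c d -> uniq [:: a; b; c; d].
Proof. by rewrite /good_switch /= !inE -!val_eqE /=; lia. Qed.

Lemma good_switch_edges a b c d : good_switch a b c d ->
  [/\ b \in hard a, d \in hard c, c \notin hard a & d \notin hard b].
Proof. by rewrite !mem_hard /hard_edge /good_switch => ?; split; lia. Qed.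

Definition reach (G : graph n) u v l :=
  exists p, [/\ path (grel G) u p, last u p = v & size p = l].

Lemma reach_step G u v w l : reach G u v l -> w \in G v -> reach G u w l.+1.
Proof.
move=> [p [up pv pl]] vw; exists (rcons p w); split.
- by rewrite rcons_path up pv.
- by rewrite last_rcons.
- by rewrite size_rcons pl.
Qed.

(** The source of lower bounds on distances, as [reach] is of upper bounds. *)
Lemma path_potential (G : graph n) (f : 'I_n -> nat) u p :
  (forall v w, w \in G v -> f w <= (f v).+1) ->
  path (grel G) u p -> f (last u p) <= f u + size p.
Proof.
move=> fG; elim: p u => [|v p IH] u /=; first by rewrite addn0.
case/andP=> uv /IH /leq_trans -> //.
by rewrite addnS -addSn leq_add2r fG.
Qed.

Definition dist_nat (x y : nat) := (x - y) + (y - x).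

Lemma dist_nat_step (x y z : nat) : (y == x.+1) || (x == y.+1) -> dist_nat x z <= (dist_nat y z).+1.
Proof. by rewrite /dist_nat; lia. Qed.

(** Removing the edge zw splits the line into the points nearer to [z] and those nearer to [w]; any
    other edge xy lies within one part. *)
Lemma dist_nat_same_side (x y z w : nat) : (y == x.+1) || (x == y.+1) ->
  (z == w.+1) || (w == z.+1) ->
  (x != z) || (y != w) -> (x != w) || (y != z) ->
  (dist_nat x z < dist_nat x w) = (dist_nat y z < dist_nat y w).
Proof.
move=> xy zw h1 h2; rewrite /dist_nat.
by case/orP: xy => /eqP ?; case/orP: zw => /eqP ?; subst; lia.
Qed.

(** One step from [x] to the nearer end of zw. The bounds keep [y] among the path vertices, and
    avoiding [w] means that the step is not the removed edge. *)
Lemma dist_nat_toward (x z w k : nat) :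
  (z == w.+1) || (w == z.+1) -> dist_nat x z < dist_nat x w -> dist_nat x z = k.+1 ->
  exists y, [/\ minn x z <= y <= maxn x z, (y == x.+1) || (x == y.+1),
    dist_nat y z < dist_nat y w, dist_nat y z = k & (x != w) && (y != w)].
Proof.
rewrite /dist_nat => zw xzw xz.
have [xltz|zltx|Exz] := ltngtP x z; last by lia.
  by exists x.+1; case/orP: zw => /eqP ?; subst; split; lia.
by exists x.-1; case/orP: zw => /eqP ?; subst; split; lia.
Qed.

(** * Distances from the source after a switch *)

Section Switched.

Context {a b c d s : 'I_n}.
Hypothesis good : good_switch a b c d.
Hypothesis s0 : s = 0 :> nat.
Hypothesis m_gt1 : 1 < m.

Let G := switch hard a b c d (good_switch_uniq _ _ _ _ good).

Lemma switched_sym : symmetric (grel G).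
Proof. by have [? ? ? ?] := good_switch_edges _ _ _ _ good; apply: switch_sym => //; apply: hard_sym. Qed.

Lemma switched_arc u v : (v \in G u) =
    hard_edge m u v && ((u, v) \notin [:: (a, b); (b, a); (c, d); (d, c)])
    || ((u, v) \in [:: (a, c); (c, a); (b, d); (d, b)]).
Proof.
have [? ? ? ?] := good_switch_edges _ _ _ _ good.
by rewrite -mem_hard; apply: arc_switch => //; apply: hard_sym.
Qed.

Lemma switched_old u v : hard_edge m u v ->
  (u != a :> nat) || (v != b :> nat) -> (u != b :> nat) || (v != a :> nat) ->
  (u != c :> nat) || (v != d :> nat) -> (u != d :> nat) || (v != c :> nat) ->
  v \in G u.
Proof.
move=> uv h1 h2 h3 h4; rewrite switched_arc uv /= !inE !xpair_eqE -!val_eqE /=.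
by rewrite !negb_or !negb_and h1 h2 h3 h4.
Qed.

(** The distance from [s] in [G]: the side of [c] is entered from [a], at distance 2, the side of
    [d] from [b], at distance 1. *)
Definition potential (u : nat) : nat :=
  if u < m then (if u == 0 then 0 else 2) else
  if u < m + m then 1 else
  if dist_nat u c < dist_nat u d then 3 + dist_nat u c else 2 + dist_nat u d.

Lemma potential_arc u v : v \in G u -> potential v <= (potential u).+1.
Proof.
have := good; rewrite /good_switch switched_arc /potential /dist_nat.
case/and5P=> /andP[a0 am] /andP[mb bm] mc md cd.
rewrite !inE !xpair_eqE -!val_eqE /= => /orP[/andP[]|].
  rewrite !negb_or !negb_and => uv /and4P[h1 h2 h3 h4].
  case/or3P: uv; [by do !case: ifP; lia|by do !case: ifP; lia|].
  case/and3P=> um vm uv.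
  rewrite !ltnNge !(leq_trans (leq_addr m m)) //= um vm /= -!ltnNge.
  have vu : (v == u.+1 :> nat) || (u == v.+1 :> nat) by rewrite orbC.
  (* A path edge other than cd has both ends on the same side. *)
  rewrite -(dist_nat_same_side u v) //.
  by case: ifP => _; rewrite -addnS leq_add2l dist_nat_step.
by case/or4P=> /andP[/eqP-> /eqP->]; do !case: ifP; lia.
Qed.

Lemma path_to_far_side p x : m + m <= x -> dist_nat x c < dist_nat x d ->
  path (grel G) s p -> last s p = x -> 3 + dist_nat x c <= size p.
Proof.
move=> mx xc sp px.
have := path_potential G (fun u => potential u) s p potential_arc sp.
rewrite /= px s0 /potential xc (ltnW m_gt1) (ltnNge x m) (ltnNge x) mx.
by rewrite (leq_trans (leq_addr m m)).
Qed.

Lemma reach_right x : m <= x < m + m -> reach G s x 1.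
Proof.
move=> mx; have := good; rewrite /good_switch => gd.
exists [:: x]; split=> //=; rewrite andbT; apply: switched_old;
  by rewrite /hard_edge s0; lia.
Qed.

Lemma reach_left x : 0 < x < m -> reach G s x 2.
Proof.
move=> mx; have := good; rewrite /good_switch => gd.
(* A common neighbor of [s] and [x] other than [b], in case [x] is [a]; it exists because
   [m > 1]. *)
have hy : (if b == m :> nat then m.+1 else m) < n by have := ltn_ord c; case: ifP; lia.
apply: (@reach_step G s (Ordinal hy)).
  by apply: reach_right => /=; case: ifP; lia.
by apply: switched_old => /=; rewrite ?/hard_edge; case: ifP => /eqP; lia.
Qed.

(** Walk outward from [z] along the path, by induction on the distance to [z]; no step crosses the
    lost edge cd. *)
Lemma reach_outside z z' l : (z, z') \in [:: (c, d); (d, c)] -> reach G s z l ->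
  forall x, m + m <= x -> dist_nat x z < dist_nat x z' -> reach G s x (l + dist_nat x z).
Proof.
move=> zz' sz x mx xz; have := good; rewrite /good_switch => gd.
have {}zz' : z = c /\ z' = d \/ z = d /\ z' = c.
  by move: zz'; rewrite !inE !xpair_eqE => /orP[]/andP[/eqP-> /eqP->]; auto.
have mz : m + m <= z by case: zz' => -[-> _]; clear -gd; lia.
have adj_z : (z == z'.+1 :> nat) || (z' == z.+1 :> nat).
  by case: zz' => -[-> ->]; clear -gd; lia.
have [am bm] : a < m + m /\ b < m + m by clear -gd; lia.
clear gd; move Ek : (dist_nat x z) => k; elim: k x mx xz Ek => [|k IH] x mx xz Ek.
  rewrite addn0 (_ : x = z) //; apply: val_inj.
  by move: Ek; rewrite /dist_nat => /= Ek'; clear -Ek'; lia.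
have [y [yxz yx yz Ey /andP[xz' yz']]] := dist_nat_toward x z z' k adj_z xz Ek.
have yn : y < n.
  by case/andP: yxz => _ /leq_ltn_trans -> //; rewrite gtn_max !ltn_ord.
have my : m + m <= y by case/andP: yxz => /(leq_trans _) -> //; rewrite leq_min mx mz.
rewrite addnS; apply: reach_step (IH (Ordinal yn) my yz Ey) _.
apply: switched_old; rewrite /= 1?[y == a]gtn_eqF ?[y == b]gtn_eqF ?(leq_trans _ my) //.
- by rewrite /hard_edge my mx yx !orbT.
- by case: zz' => -[? ?]; subst z z'; rewrite ?xz' ?yz' ?orbT.
- by case: zz' => -[? ?]; subst z z'; rewrite ?xz' ?yz' ?orbT.
Qed.

Lemma reach_near_side x : m + m <= x -> dist_nat x d < dist_nat x c ->
  reach G s x (2 + dist_nat x d).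
Proof.
move=> mx xd; apply: (reach_outside d c) => //; first by rewrite !inE eqxx orbT.
have := good; rewrite /good_switch => gd.
apply: (@reach_step G s b); first by apply: reach_right; lia.
by rewrite switched_arc !inE eqxx !orbT.
Qed.

Lemma reach_far_side x : m + m <= x -> dist_nat x c < dist_nat x d ->
  reach G s x (3 + dist_nat x c).
Proof.
move=> mx xd; apply: (reach_outside c d) => //; first by rewrite !inE eqxx.
have := good; rewrite /good_switch => gd.
apply: (@reach_step G s a); first by apply: reach_left; lia.
by rewrite switched_arc !inE eqxx !orbT.
Qed.

(** No tie occurs, since [c] and [d] are consecutive. *)
Lemma switched_side x :
  dist_nat x c < dist_nat x d \/ dist_nat x d < dist_nat x c.
Proof. by have := good; clear -a b c d x; rewrite /good_switch /dist_nat; lia. Qed.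

Lemma switched_connected : connected_graph G.
Proof.
have sG x : connect (grel G) s x.
  suff [l [p [sp px _]]] : exists l, reach G s x l by apply/connectP; exists p.
  have [xm|mx] := ltnP x m.
    have [x0|x0] := posnP x; last by exists 2; apply: reach_left; rewrite x0.
    by exists 0, [::]; split=> //; apply: val_inj; rewrite /= s0 x0.
  have [xmm|mmx] := ltnP x (m + m); first by exists 1; apply: reach_right; rewrite mx.
  have [xc|xd] := switched_side x.
    by exists (3 + dist_nat x c); apply: reach_far_side.
  by exists (2 + dist_nat x d); apply: reach_near_side.
move=> u v; apply: connect_trans (sG v).
by rewrite (sym_connect_sym switched_sym).
Qed.

End Switched.

(** * Degrees, sparsity and the effect of the two switches *)

Lemma count_ord_interval lo hi : hi <= n ->
  size [seq v : 'I_n <- enum 'I_n | lo <= v < hi] = hi - lo.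
Proof.
move=> hin; rewrite -(size_map (@nat_of_ord n)) -(size_iota lo (hi - lo)); apply: perm_size.
apply: uniq_perm; first by rewrite (map_inj_uniq (@ord_inj n)) filter_uniq ?enum_uniq.
  exact: iota_uniq.
move=> k; rewrite mem_iota; apply/mapP/idP => [[v]|hk].
  by rewrite mem_filter => /andP[hv _] ->; rewrite /=; lia.
have kn : k < n by lia.
by exists (Ordinal kn); rewrite // mem_filter mem_enum andbT /=; lia.
Qed.

Lemma size_hard u : m + m <= n ->
  (u < m + m -> size (hard u) = m) /\ (m + m <= u -> size (hard u) <= 2).
Proof.
move=> mn; split=> um.
  rewrite -[RHS](addnK m); have [ul|ur] := ltnP u m.
    rewrite -(count_ord_interval m (m + m)) //; congr size; apply: eq_filter => v.
    by rewrite /hard_edge; lia.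
  rewrite addnK -[RHS]subn0 -(count_ord_interval 0 m); last by lia.
  by congr size; apply: eq_filter => v; rewrite /hard_edge; lia.
rewrite -(size_map (@nat_of_ord n)) -[2]/(size [:: u.+1; u.-1]); apply: uniq_leq_size.
  by rewrite (map_inj_uniq (@ord_inj n)) hard_uniq.
move=> k /mapP[v]; rewrite mem_hard => uv ->; rewrite !inE.
by move: uv; rewrite /hard_edge /=; lia.
Qed.

Lemma sum_degrees_hard : m + m <= n ->
  \sum_(v < n) size (hard v) <= (m + m) * m + (n - (m + m)) * 2.
Proof.
move=> mn; pose F (v : nat) := if v < m + m then m else 2.
suff <- : \sum_(v < n) F v = (m + m) * m + (n - (m + m)) * 2.
  apply: leq_sum => v _; have [h1 h2] := size_hard v mn; rewrite /F.
  by case: ltnP => [/h1->|/h2].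
rewrite -(big_mkord xpredT F) (big_cat_nat (n := m + m)) //=.
rewrite (eq_big_nat _ _ (F2 := fun=> m)) => [|v /andP[_ vm]]; last by rewrite /F vm.
rewrite [X in _ + X](eq_big_nat _ _ (F2 := fun=> 2)); last first.
  by move=> v /andP[mv _]; rewrite /F ltnNge mv.
by rewrite !sum_nat_const_nat subn0.
Qed.

Lemma max_degree_hard : 1 < m -> m + m <= n -> max_degree hard = m.
Proof.
move=> m1 mn; apply/eqP; rewrite eqn_leq; apply/andP; split.
  apply/bigmax_leqP => v _; have [h1 h2] := size_hard v mn.
  by case: (ltnP v (m + m)) => [/h1->|/h2 /leq_trans->].
have n0 : 0 < n by lia.
have [/= h _] := size_hard (Ordinal n0) mn.
rewrite -{1}h; last by lia.
exact: (leq_bigmax (Ordinal n0)).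
Qed.

(** The degrees sum to at most 2m^2 + 2n, and m^2 <= n; hence the constant 4. *)
Lemma good_switch_sparse_connected a b c d (good : good_switch a b c d) :
  1 < m -> m + m + m * m <= n ->
  sparse_connected_inputs false 4%:R
    (switch hard a b c d (good_switch_uniq _ _ _ _ good)).
Proof.
move=> m1 mn.
have n0 : 0 < n by lia.
split; first by move=> _; apply: switched_sym.
  exact: (@switched_connected _ _ _ _ (Ordinal n0) good).
rewrite /average_degree ler_pdivrMr ?ltr0n // -natrM ler_nat.
under eq_bigr do rewrite size_map.
by apply: leq_trans (sum_degrees_hard _) _; lia.
Qed.

Lemma max_degree_switch (G : graph n) a b c d (abcd : uniq [:: a; b; c; d]) :
  max_degree (switch G a b c d abcd) = max_degree G.
Proof. by apply: eq_bigr => v _; rewrite size_map. Qed.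

(* The vertices on the side of c in the path without the edge cd are one step
   closer to s when c is joined to b than when it is joined to a. *)
Lemma dist_switch_neq a b c d (s : 'I_n) x k (good : good_switch a b c d)
    (good' : good_switch a b d c) :
  s = 0 :> nat -> 1 < m -> m + m <= x ->
  is_dist (switch hard a b c d (good_switch_uniq _ _ _ _ good)) s x k ->
  ~ is_dist (switch hard a b d c (good_switch_uniq _ _ _ _ good')) s x k.
Proof.
move=> s0 m1 mx.
(* Exchanging [c] and [d] exchanges the two graphs. *)
wlog xc : c d good good' / dist_nat x c < dist_nat x d.
  move=> W; have [xc|/W W' h1 h2] := switched_side good x; first exact: W.
  exact: W' h2 h1.
(* With [c] joined to [b] there is a walk of length 2 + |x - c|; with [c] joined to [a] every walk
   is longer. The walk also refutes [None]. *)
have [p [sp px pl]] := @reach_near_side _ _ _ _ _ good' s0 m1 x mx xc.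
case: k => [k [[p' [sp' px' <-]] _] [_ /(_ p sp px)]|_]; last by move/(_ p sp).
have := @path_to_far_side _ _ _ _ _ good s0 m1 p' x mx xc sp' px'.
by rewrite pl; lia.
Qed.

End Hard.

(** * The adversary argument *)

(** This covers a halt before time [T], since halted configurations are fixed. *)
Lemma final_iter (A : algorithm) n (G : graph n) s (q : config n (Defs.mem A)) T :
  final G s q -> exists k, q = iter k (tick G) (iter T (tick G) (start A s)).
Proof.
by case=> -[k qE] hq; exists k; rewrite -iterD addnC iterD -qE iter_tick_halted.
Qed.

Lemma hard_delay (A : algorithm) (m : nat) :
  1 < m -> solves_SSSD (sparse_connected_inputs false 4%:R) A ->
  exists (n : nat) (G : graph n) (s : 'I_n) (d : nat),
    [/\ sparse_connected_inputs false 4%:R G, max_degree G = m,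
        has_delay A G s d & m <= 10 * d].
Proof.
move=> m1 AP; pose n := (m + m + m * m).+1.
have mn : m + m <= n by rewrite /n; lia.
(* The m(m-1) edges of K_{m,m} away from [s] and the m^2 path edges each outnumber the [T] reads. *)
pose s : 'I_n := ord0; pose T := m.-1 * m.-1.
(* [H] is disconnected, so correctness of [A] says nothing about it; only the first [T] steps on it
   are used. *)
pose H := @hard m n; pose q0 := start A s; pose L := probes H q0 T.
have sL : size L <= T := size_probes _ _ _.
pose I lo hi := [seq v : 'I_n <- enum 'I_n | lo <= v < hi].
have memI lo hi v : (v \in I lo hi) = (lo <= v < hi) by rewrite mem_filter mem_enum andbT.
have uI lo hi : uniq (I lo hi) by rewrite filter_uniq ?enum_uniq.
have [a [b [abE ab ba]]] : exists a b, [/\ (a, b) \in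
    [seq (u, v) | u <- I 1 m, v <- I m (m + m)], (a, b) \notin L & (b, a) \notin L].
  apply: exists_unoriented_notin.
  - by apply: allpairs_uniq => // -[? ?] [? ?] _ _ [-> ->].
  - by move=> _ /allpairsP[[u v] [/= + + ->]] /=; rewrite !memI; lia.
  - rewrite size_allpairs !count_ord_interval; [|lia..].
    by apply: leq_ltn_trans sL _; rewrite /T; nia.
have {abE}[ha hb] : 0 < a < m /\ m <= b < m + m.
  by case/allpairsP: abE => -[u v] [/= + + [-> ->]]; rewrite !memI.
(* Path edges are listed by their lower ends; [u < n.-1] makes [inord] exact. *)
have [c [d [cdE cd dc]]] : exists c d, [/\ (c, d) \in
    [seq (u, inord u.+1 : 'I_n) | u : 'I_n <- I (m + m) n.-1], (c, d) \notin L & (d, c) \notin L].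
  apply: exists_unoriented_notin.
  - by rewrite map_inj_uniq // => u v [].
  - by move=> _ /mapP[u + ->] /=; rewrite memI => hu; rewrite inordK //; rewrite /n /= in hu *; lia.
  - rewrite size_map count_ord_interval /n /=; last by lia.
    by apply: leq_ltn_trans sL _; rewrite /T; nia.
have {cdE}[hc hd] : m + m <= c /\ d = c.+1 :> nat.
  case/mapP: cdE => u; rewrite memI => hu [-> ->]; rewrite inordK //; first by lia.
  by rewrite /n /= in hu *; lia.
have good : @good_switch m n a b c d by rewrite /good_switch; lia.
have good' := good_switchC _ _ _ _ good.
have [_ _ nca nbd] := good_switch_edges _ _ _ _ good.
have [_ _ nda nbc] := good_switch_edges _ _ _ _ good'.
have sym u v : (v \in H u) = (u \in H v) := hard_sym u v.
pose G := switch H a b c d (good_switch_uniq _ _ _ _ good).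
pose G' := switch H a b d c (good_switch_uniq _ _ _ _ good').
pose qT := iter T (tick H) q0.
have GT : iter T (tick G) q0 = qT.
  apply: iter_tick_switch; rewrite // 1?sym // => e eL; apply: contraTN eL.
  by rewrite !inE => /or4P[] /eqP->.
have GT' : iter T (tick G') q0 = qT.
  apply: iter_tick_switch; rewrite // 1?sym // => e eL; apply: contraTN eL.
  by rewrite !inE => /or4P[] /eqP->.
have GP : sparse_connected_inputs false 4%:R G by apply: good_switch_sparse_connected.
have GP' : sparse_connected_inputs false 4%:R G' by apply: good_switch_sparse_connected.
have [q qf [qperm qdist]] := AP n G s GP.
have [q' q'f [_ q'dist]] := AP n G' s GP'.
have [k qE] := final_iter _ _ _ _ _ T qf.
have [k' q'E] := final_iter _ _ _ _ _ T q'f.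
rewrite -/G -/q0 GT in qE; rewrite -/G' -/q0 GT' in q'E.
have [qTq [l ql lT]] := log_iter_tick G qT k.
have [_ [l' q'l _]] := log_iter_tick G' qT k'.
rewrite -qE in qTq ql; rewrite -q'E in q'l.
(* A pair output within the first [T] steps is in both final logs, so it would be a correct distance
   in [G] and in [G']. *)
have inside o : o \in map fst (log qT) -> o.1 < m + m.
  move=> oT; rewrite ltnNge; apply/negP => mo.
  apply: (@dist_switch_neq m n a b c d s o.1 o.2 good good') => //.
    by apply: qdist; rewrite ql map_cat mem_cat oT.
  by apply: q'dist; rewrite q'l map_cat mem_cat oT.
have quniq : uniq [seq o.1 | o <- map fst (log q)] by rewrite (perm_uniq qperm) enum_uniq.
have size_qT : size (log qT) <= m + m.
  rewrite -[leqRHS]subn0 -(count_ord_interval 0 (m + m) mn).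
  rewrite -(size_map fst) -(size_map fst); apply: uniq_leq_size.
    by move: quniq; rewrite ql !map_cat cat_uniq => /and3P[].
  by move=> _ /mapP[o /inside om ->]; rewrite memI.
(* A halt by then would mean that all n > 2m vertices had been output. *)
have qT_running : ~~ halted qT.
  apply/negP => hT; have := perm_size qperm.
  rewrite qE (iter_tick_halted _ _ _ hT) size_enum_ord !size_map /n => sz.
  by move: size_qT; rewrite sz leqNgt ltnS leq_addr.
have clock_qT : clock qT = T by rewrite clock_iter_tick.
rewrite clock_qT in qTq lT.
have [e eq Te] := exists_delay_ge _ _ q T _ _ ql lT qTq.
exists n, G, s, e; split=> //; first by rewrite max_degree_switch max_degree_hard.
  by exists q.
have {}Te : T <= e * (m + m).+1 by apply: leq_trans Te _; rewrite leq_mul2l ltnS size_qT orbT.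
rewrite leqNgt; apply/negP => em; move: Te; rewrite /T; clear -m1 em.
case: m m1 em => // p p0 ep /= Te.
(* With p = m - 1, [Te] and 10e <= p give 10p^2 <= p(2p + 3), impossible for p >= 1. *)
have : 10 * (p * p) <= p * (p.+1 + p.+1).+1.
  by apply: leq_trans (leq_mul (leqnn 10) Te) _; rewrite mulnA leq_mul2r -ltnS ep orbT.
by clear -p0; nia.
Qed.

Theorem theorem2 :
  exists C : rat, forall directed : bool,
    (forall A : algorithm,
       solves_SSSD (sparse_connected_inputs directed C) A ->
       ~ delay_in_little_o_max_degree (sparse_connected_inputs directed C) A)
    /\
    (forall A : algorithm,
       solves_SSSD (inputs directed) A ->
       exists2 c : rat, (0 < c)%R &
       forall D : nat,
       exists (n : nat) (G : graph n) (s : 'I_n) (d : nat),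
         [/\ sparse_connected_inputs directed C G,
             D <= max_degree G,
             has_delay A G s d &
             (c * (max_degree G)%:R <= d%:R)%R]).
Proof.
exists 4%:R%R => directed.
(* The hard inputs are undirected, so they serve both values of [directed]. *)
have undirected n (G : graph n) :
  sparse_connected_inputs false 4%:R G -> sparse_connected_inputs directed 4%:R G.
  by case=> Gsym Gconn Gavg; split=> // _; apply: Gsym.
have lower (A : algorithm) : solves_SSSD (sparse_connected_inputs false 4%:R) A ->
  forall D : nat, exists (n : nat) (G : graph n) (s : 'I_n) (d : nat),
    [/\ sparse_connected_inputs directed 4%:R G, D.+2 <= max_degree G, has_delay A G s d &
        ((10%:R)^-1 * (max_degree G)%:R <= d%:R :> rat)%R].
  (* Taking m = D + 2 ensures 1 < m as well as a maximum degree above [D]. *)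
  move=> AP D; have [n [G [s [d [GP Gm Gd md]]]]] := hard_delay A D.+2 isT AP.
  exists n, G, s, d; split=> //; [exact: undirected|by rewrite Gm|].
  by rewrite mulrC ler_pdivrMr ?ltr0n // -natrM ler_nat mulnC Gm.
split=> A AP.
  (* Any factor below 1/10 contradicts the bound, as the maximum degree is positive. *)
  move=> /(_ (20%:R)^-1%R); case=> [|D small]; first by rewrite invr_gt0 ltr0n.
  have [|n [G [s [d [GP Gm Gd md]]]]] := lower A _ D.
    by move=> n G s /undirected; apply: AP.
  have /(le_trans md) := small n G s d GP (leq_trans (leqW (leqnSn _)) Gm) Gd.
  by rewrite ler_pM2r ?ltr0n ?(leq_trans _ Gm).
exists (10%:R)^-1%R; first by rewrite invr_gt0 ltr0n.
move=> D; have [|n [G [s [d [GP Gm Gd md]]]]] := lower A _ D.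
  by move=> n G s /undirected[Gsym _ _]; apply: AP.
by exists n, G, s, d; split=> //; apply: leq_trans Gm; apply: leqW.
Qed.
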